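(* Let $b\in\mathbb{R}^n\setminus\mathbb{Z}^n$ and let $C^P$ be a nonempty corner polyhedron where $P\subseteq\mathbb{Q}^n$ is finite. Any valid (linear) inequality for $C^P$ that is not valid for $\mathbb{R}^P_+$ is dominated by the restriction to $\mathbb{R}^P$ of the inequality defined by some nontrivial, minimal, liftable tuple for $I_b$, i.e. by an inequality $\sum_{p\in P}\pi(p)y(p)\ge\alpha$ where $(\pi,\alpha)$ is a nontrivial minimal liftable valid tuple for $I_b$.
   Context: $M_b$ is the set of all pairs $(s,y)$ of finite-support functions $s:\mathbb{R}^n\to\mathbb{R}_+$, $y:\mathbb{R}^n\to\mathbb{Z}_+$ such that $\sum_{r\in\mathbb{R}^n} r\,s(r)+\sum_{p\in\mathbb{R}^n}p\,y(p)\in b+\mathbb{Z}^n$. $I_b$ is the set of finite-support $y:\mathbb{R}^n\to\mathbb{Z}_+$ with $(0,y)\in M_b$. For finite $P\subseteq\mathbb{R}^n$, the corner polyhedron $C^P$ is the set of $y\in\operatorname{conv}(I_b)$ (convex hull) with $y(p)=0$ for all $p\notin P$, viewed as a subset of $\mathbb{R}^P$ by dropping the variables set to $0$. A tuple $(\psi,\pi,\alpha)$ with $\psi,\pi:\mathbb{R}^n\to\mathbb{R}$ is valid for $M_b$ if $\sum_r\psi(r)s(r)+\sum_p\pi(p)y(p)\ge\alpha$ for all $(s,y)\in M_b$; a tuple $(\pi,\alpha)$ is valid for $I_b$ if $\sum_p\pi(p)y(p)\ge\alpha$ for all $y\in I_b$. By positive rescaling, tuples are assumed to have $\alpha\in\{-1,0,1\}$.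 A valid tuple $(\pi,\alpha)$ for $I_b$ is minimal if there is no $\pi'\ne\pi$ with $\pi'\le\pi$ pointwise and $(\pi',\alpha)$ valid for $I_b$; it is trivial if $\pi\ge0$ and $\alpha\in\{0,-1\}$, and nontrivial otherwise; it is liftable if there exists $\psi:\mathbb{R}^n\to\mathbb{R}$ such that $(\psi,\pi,\alpha)$ is a valid tuple for $M_b$. An inequality is valid for a set if all points of the set satisfy it. An inequality on $\mathbb{R}^P$ is dominated by another one if every $y\in\mathbb{R}^P_+$ satisfying the latter also satisfies the former. *)

(* Defs.v *)
From HB Require Import structures.
From mathcomp Require Import all_boot all_order all_algebra finmap.
From mathcomp Require Import all_classical all_reals all_analysis.

Set Implicit Arguments.
Unset Strict Implicit.
Unset Printing Implicit Defensive.

Import Order.TTheory GRing.Theory Num.Theory.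

Local Open Scope classical_set_scope.
Local Open Scope ring_scope.

Section InfiniteModels.
Context {R : realType} {n : nat}.

Local Notation Rn := 'rV[R]_n.

(* The sums below range over all of R^n; [\sum_(i \in A) F i] is the sum over
   the indices where F is nonzero, and is 0 by convention if there are
   infinitely many of them. The finiteness conditions in [mixed_model] (hence
   in [integer_model]) ensure that this convention never applies. *)

Definition ratvec (v : Rn) : Prop := exists q : 'rV[rat]_n, v = map_mx ratr q.

Definition mixed_model (b : Rn) : set ((Rn -> R) * (Rn -> nat)) :=
  [set sy | [/\ forall r, 0 <= sy.1 r,
                finite_set [set r | sy.1 r != 0],
                finite_set [set p | sy.2 p != 0%N] &
                \sum_(r \in [set: Rn]) (sy.1 r *: r)
                  + \sum_(p \in [set: Rn]) (p *+ sy.2 p) - b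
                  \is a mxOver Num.int]].

Definition integer_model (b : Rn) : set (Rn -> nat) :=
  [set y | mixed_model b (fun=> 0, y)].

(* Tuples are considered up to positive rescaling, so validity of a tuple
   includes this normalization of its right-hand side. *)
Definition normalized_rhs (alpha : R) : Prop :=
  [\/ alpha = -1, alpha = 0 | alpha = 1].

Definition valid_mixed (b : Rn) (psi pi : Rn -> R) (alpha : R) : Prop :=
  normalized_rhs alpha /\
  forall sy, mixed_model b sy ->
    alpha <= \sum_(r \in [set: Rn]) (psi r * sy.1 r)
             + \sum_(p \in [set: Rn]) (pi p * (sy.2 p)%:R).

Definition valid_integer (b : Rn) (pi : Rn -> R) (alpha : R) : Prop :=
  normalized_rhs alpha /\
  forall y, integer_model b y ->
    alpha <= \sum_(p \in [set: Rn]) (pi p * (y p)%:R).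

Definition minimal_tuple (b : Rn) (pi : Rn -> R) (alpha : R) : Prop :=
  valid_integer b pi alpha /\
  ~ exists pi' : Rn -> R,
      [/\ pi' <> pi, forall p, pi' p <= pi p & valid_integer b pi' alpha].

Definition trivial_tuple (pi : Rn -> R) (alpha : R) : Prop :=
  (forall p, 0 <= pi p) /\ (alpha = 0 \/ alpha = -1).

Definition liftable_tuple (b : Rn) (pi : Rn -> R) (alpha : R) : Prop :=
  exists psi : Rn -> R, valid_mixed b psi pi alpha.

Definition convex_hull {M : lmodType R} (A : set M) : set M :=
  smallest (@convex_set R M) A.

(* The codomain is written R^o so that R^n -> R^o is a real vector space. *)
Definition conv_integer_model (b : Rn) : set (Rn -> R^o) :=
  convex_hull [set (fun p => (y p)%:R) | y in integer_model b].

Definition restrict_coords (P : {fset Rn}) (x : Rn -> R) : {ffun P -> R} :=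
  [ffun p : P => x (val p)].

Definition corner_polyhedron (b : Rn) (P : {fset Rn}) : set {ffun P -> R} :=
  [set restrict_coords P x | x in
     [set x | conv_integer_model b x /\ forall p, p \notin P -> x p = 0]].

Definition orthant (P : {fset Rn}) : set {ffun P -> R} :=
  [set y | forall p, 0 <= y p].
Arguments orthant : clear implicits.

(* The inequality \sum_p gamma(p) y(p) >= delta is identified with its solution
   set; it is valid for S iff S is included in that set. *)
Definition halfspace (P : {fset Rn}) (gamma : {ffun P -> R}) (delta : R) :
    set {ffun P -> R} :=
  [set y | delta <= \sum_(p : P) gamma p * y p].

Definition ineq_dominated (P : {fset Rn}) (gamma1 : {ffun P -> R}) (delta1 : R)
    (gamma2 : {ffun P -> R}) (delta2 : R) : Prop :=
  orthant P `&` halfspace gamma2 delta2 `<=` halfspace gamma1 delta1.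

End InfiniteModels.

Arguments orthant {R n} P.
Arguments corner_polyhedron {R n} b P.
Arguments restrict_coords {R n} P x.

(* Main.v *)
(* Rationality makes the recession cone of C^P the whole orthant, so
   [gamma >= 0] and [delta > 0]. Let [pi0] be [gamma / delta] on [P] and [1]
   elsewhere, let [D] be a common denominator of [P] and [b], and let
   [psi r = D |r|_1]. Then [(psi, pi0, 1)] is valid for M_b: using a point
   outside [P] costs at least [1], and otherwise the continuous part lies in
   [(1/D) Z^n], so it is [0] or costs at least [1]. By Zorn, take [pi] minimal
   among the [0 <= pi <= pi0] for which [(psi, pi, 1)] is valid for M_b.
   Minimality with [psi] fixed already gives subadditivity, hence the symmetry
   [pi x + pi (b - x) = 1], and symmetry forces minimality for I_b. *)

Require Import Defs.
From mathcomp Require Import all_boot all_order all_algebra finmap.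
From mathcomp Require Import all_classical all_reals all_analysis.
From mathcomp Require Import lra.

Import Order.TTheory GRing.Theory Num.Theory.

Local Open Scope classical_set_scope.
Local Open Scope ring_scope.

(* [Num.int] is a qualifier, so that the closure instances of [mxOver] are not
   found for [mxOver Num.int]. *)
Section IntegerMatrices.
Context {R : archiNumDomainType} {m n : nat}.
Implicit Types u v : 'M[R]_(m, n).

Lemma intmx0 : (0 : 'M[R]_(m, n)) \is a mxOver Num.int.
Proof. by apply/mxOverP => i j; rewrite mxE rpred0. Qed.

Lemma intmxD u v : u \is a mxOver Num.int -> v \is a mxOver Num.int ->
  u + v \is a mxOver Num.int.
Proof.
by move=> /mxOverP u_int /mxOverP v_int; apply/mxOverP => i j; rewrite mxE rpredD.
Qed.

Lemma intmxN u : u \is a mxOver Num.int -> - u \is a mxOver Num.int.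
Proof. by move=> /mxOverP u_int; apply/mxOverP => i j; rewrite mxE rpredN. Qed.

Lemma intmxMn u k : u \is a mxOver Num.int -> u *+ k \is a mxOver Num.int.
Proof. by move=> u_int; elim: k => [|k IHk]; rewrite ?intmx0 ?mulrS ?intmxD. Qed.

End IntegerMatrices.

(** * Finite-support functions to [nat] as multiplicity functions of sequences *)

Section Multisets.
Context {T : choiceType}.

Lemma fsum_count_mem {V : nmodType} (f : T -> V) (l : seq T) :
  \sum_(p \in [set: T]) (f p *+ count_mem p l) = \sum_(p <- l) f p.
Proof.
rewrite (@fsbigE _ _ _ _ _ (undup l)) ?undup_uniq//.
  under eq_bigl do rewrite in_setT.
  exact: big_undup_iterop_count.
by move=> p _; rewrite mem_undup => /count_memPn ->.
Qed.

(** Integer points can thus be handled as sequences, whose entries can be appended, removed or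
    replaced one at a time. *)
Lemma exists_count_mem (y : T -> nat) :
  finite_set [set p | y p != 0%N] -> exists l, y = fun p => count_mem p l.
Proof.
move=> fy.
have E s : uniq s ->
    exists l, forall p, count_mem p l = if p \in s then y p else 0%N.
  elim: s => [_|q s IHs /= /andP[qs /IHs[l lP]]]; first by exists [::].
  exists (nseq (y q) q ++ l) => p; rewrite count_cat count_nseq lP in_cons /=.
  rewrite (eq_sym q).
  by have [->|_] := eqVneq p q; rewrite ?(negPf qs) ?mul1n ?addn0.
have [l lP] := E _ (fset_uniq (fset_set [set p | y p != 0%N])).
exists l; apply/funext => p; rewrite lP in_fset_set//; case: ifPn => //.
by rewrite notin_setE /= => /negP; rewrite negbK => /eqP.
Qed.

End Multisets.

(** * Minimal functions for a fixed sublinear [N], and their symmetry *)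

Section SublinearLifting.
Context {R : realType} {n : nat}.
Local Notation Rn := 'rV[R]_n.
Implicit Types (b r x : Rn) (l : seq Rn) (pi : Rn -> R).

Lemma integer_model_count_mem b l :
  \sum_(p <- l) p - b \is a mxOver Num.int ->
  integer_model b (fun p => count_mem p l).
Proof.
move=> lb; split => //=.
- rewrite [X in finite_set X](_ : _ = set0)//.
  by apply/seteqP; split => // r /=; rewrite eqxx.
- apply: (sub_finite_set _ (finite_seq l)) => p /=.
  by rewrite -lt0n -has_count has_pred1.
- by rewrite fsbig1 ?add0r ?fsum_count_mem// => r _; rewrite scale0r.
Qed.

Lemma valid_integer_count_mem b pi alpha l : valid_integer b pi alpha ->
  \sum_(p <- l) p - b \is a mxOver Num.int -> alpha <= \sum_(p <- l) pi p.
Proof.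
move=> [_ pi_valid] /integer_model_count_mem /pi_valid.
under eq_fsbigr do rewrite mulr_natr.
by rewrite fsum_count_mem.
Qed.

(* Since a sublinear [N] satisfies [N (sum r s(r)) <= sum N(r) s(r)], the
   continuous variables can be aggregated into a single point [r]. *)
Definition sublinear_valid (N : Rn -> R) b pi :=
  forall r l, r + \sum_(p <- l) p - b \is a mxOver Num.int ->
    1 <= N r + \sum_(p <- l) pi p.

Context (N : Rn -> R).
Context (N_ge0 : forall r, 0 <= N r).
Context (ND : forall r r', N (r + r') <= N r + N r').
Context (NZ : forall a r, 0 <= a -> N (a *: r) = a * N r).

Lemma sublinear0 : N 0 = 0.
Proof. by rewrite -(scale0r 0) NZ// mul0r. Qed.

Lemma sublinear_valid_mixed b pi :
  sublinear_valid N b pi -> valid_mixed b N pi 1.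
Proof.
move=> Npi; split; first by constructor 3.
move=> [s y] [/= s0 sfin /exists_count_mem[l ->]].
rewrite fsum_count_mem => /Npi; under [X in _ -> _ <= _ + X]eq_fsbigr do
  rewrite mulr_natr.
rewrite fsum_count_mem => /le_trans; apply; rewrite lerD2r.
have soff r : r \notin fset_set [set r | s r != 0] -> s r = 0.
  by rewrite in_fset_set// notin_setE /= => /negP; rewrite negbK => /eqP.
rewrite !(@fsbigTE _ _ _ _ (fset_set [set r | s r != 0])); last 2 first.
- by move=> r /soff ->; rewrite mulr0.
- by move=> r /soff ->; rewrite scale0r.
elim/big_ind2: _ => [|a u a' u' la la'|r _]; first by rewrite sublinear0.
- by apply: le_trans (ND _ _) _; exact: lerD.
- by rewrite NZ// mulrC.
Qed.

(** Competitors must be nonnegative, so that chains have pointwise infima, and valid with the same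
    [N]. This is a priori weaker than minimality for [I_b]. *)
Definition minimal_sublinear_valid b pi :=
  [/\ forall p, 0 <= pi p, sublinear_valid N b pi &
      forall pi', (forall p, 0 <= pi' p) -> sublinear_valid N b pi' ->
        (forall p, pi' p <= pi p) -> pi' = pi].

Lemma exists_minimal_sublinear_valid b pi0 :
  (forall p, 0 <= pi0 p) -> sublinear_valid N b pi0 ->
  exists2 pi, minimal_sublinear_valid b pi & forall p, pi p <= pi0 p.
Proof.
move=> pi0_ge0 pi0_valid.
pose T := { pi | [/\ forall p, 0 <= pi p, sublinear_valid N b pi &
                    forall p, pi p <= pi0 p]}.
(* The order is reversed: a maximal element for [rel] is a pointwise minimal function. *)
pose rel (u v : T) := `[< forall p, sval v p <= sval u p >].
have [||||t tmax] := @Zorn T rel.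
- by move=> t; apply/asboolP.
- move=> u v w /asboolP uv /asboolP vw; apply/asboolP => p.
  exact: le_trans (uv p).
- move=> [u Pu] [v Pv] /asboolP /= uv /asboolP /= vu.
  have E : u = v by apply/funext => p; apply/le_anti; rewrite uv vu.
  by subst v; congr exist; exact: Prop_irrelevance.
- move=> A Atot; have [->|/set0P[t0 At0]] := eqVneq A set0.
    by exists (exist _ pi0 (And3 pi0_ge0 pi0_valid (fun p => lexx (pi0 p)))).
  pose V p := [set sval t p | t in A]; pose m p := inf (V p).
  have V_lb p : lbound (V p) 0 by move=> _ [[u [u0 ? ?]] _ <-] /=.
  have V_inf p : has_inf (V p).
    by split; [exists (sval t0 p), t0|exists 0].
  have m_le t p : A t -> m p <= sval t p.
    by move=> At; apply: ge_inf; [exists 0|exists t].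
  have m_ge0 p : 0 <= m p by apply: lb_le_inf => //; exact: (V_inf p).1.
  (* Validity tests only finitely many points at a time, and in a chain one member can be close to
     the infimum at all of them. *)
  have approx e l : 0 < e ->
      exists2 t, A t & {in l, forall p, sval t p <= m p + e}.
    move=> e0; elim: l => [|q l [t At tl]]; first by exists t0.
    have [_ [u Au <-] /ltW uq] := inf_adherent e0 (V_inf q).
    have [/asboolP tu|/asboolP ut] := Atot _ _ At Au.
      exists u => // p; rewrite in_cons => /predU1P[->//|/tl].
      exact: le_trans.
    exists t => // p; rewrite in_cons => /predU1P[->|/tl//].
    exact: le_trans uq.
  have mv : sublinear_valid N b m.
    move=> r l lb; apply/ler_addgt0Pr => e e0.
    (* The [size l] errors then add up to at most [e]; the successor keeps the divisor nonzero for
       an empty [l]. *)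
    have e'0 : 0 < e / (size l).+1%:R by rewrite divr_gt0.
    have [[u [/= u0 uv _]] _ /= ul] := approx _ l e'0.
    apply: le_trans (uv _ _ lb) _; rewrite -addrA lerD2l.
    apply: (@le_trans _ _ (\sum_(p <- l) (m p + e / (size l).+1%:R))).
      rewrite big_seq [leRHS]big_seq; exact: ler_sum.
    rewrite big_split/= lerD2l big_const_seq count_predT iter_addr_0.
    by rewrite -[leLHS]mulr_natr -mulrA ler_piMr ?(ltW e0)// mulrC ler_pdivrMr//
      mul1r ler_nat.
  have m_le0 p : m p <= pi0 p.
    by case: (t0) At0 => u [/= ? ? u_le] Au; apply: le_trans (m_le _ p Au) _.
  exists (exist _ m (And3 m_ge0 mv m_le0)) => t At.
  by apply/asboolP => p /=; exact: m_le.
- case: t tmax => pi /= [pi_ge0 piv pi_le] tmax; exists pi => //; split => //.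
  move=> pi' pi'_ge0 pi'v pi'_le.
  have Ppi' : [/\ forall p, 0 <= pi' p, sublinear_valid N b pi' &
                    forall p, pi' p <= pi0 p].
    by split => // p; exact: le_trans (pi'_le p) (pi_le p).
  by have /(congr1 sval) := tmax (exist _ pi' Ppi') (introT (asboolP _) pi'_le).
Qed.

(** Otherwise [pi] could be lowered at [x] to the right-hand side and stay valid, because every use
    of [x] can be replaced by [r] and [l]. *)
Lemma minimal_sublinear_subadditive b pi r x l :
  minimal_sublinear_valid b pi -> r + \sum_(p <- l) p - x \is a mxOver Num.int ->
  pi x <= N r + \sum_(p <- l) pi p.
Proof.
move=> [pi_ge0 pi_valid pi_min] lx; rewrite leNgt; apply/negP => x_gt.
set v := N r + _ in x_gt.
pose pi' p := if p == x then v else pi p.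
have pi'E p : pi' p = if p == x then v else pi p by [].
(* Each occurrence of [x] in [l0] is replaced by [l], with its copy of [r] collected in [r1]; the
   result is priced by the original [pi]. *)
have expand l0 : exists r1 l1,
    r1 + \sum_(p <- l1) p - \sum_(p <- l0) p \is a mxOver Num.int /\
    N r1 + \sum_(p <- l1) pi p <= \sum_(p <- l0) pi' p.
  elim: l0 => [|q l0 [r1 [l1 [r1l1 le1]]]].
    by exists 0, [::]; rewrite !big_nil sublinear0 !addr0 subrr intmx0.
  rewrite !big_cons pi'E; have [->|qx] := eqVneq q x.
    exists (r + r1), (l ++ l1); rewrite !big_cat /=; split.
      by have := intmxD _ _ lx r1l1; rewrite opprD [in X in X -> _]addrACA
        [in X in X -> _](addrACA r).
    have := ND r r1; rewrite /v; move: le1.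
    move: (N (r + r1)) (N r) (N r1) => a0 a1 a2 h1 h2. lra.
  exists r1, (q :: l1); rewrite !big_cons; split; last first.
    by rewrite addrCA lerD2l.
  by rewrite (addrCA r1) opprD addrACA subrr add0r.
have pi'_ge0 p : 0 <= pi' p.
  by rewrite /pi'; case: ifP => // _; rewrite addr_ge0 ?sumr_ge0.
have pi'_valid : sublinear_valid N b pi'.
  move=> r0 l0 l0b; have [r1 [l1 [r1l1 le1]]] := expand l0.
  have : (r1 + r0) + \sum_(p <- l1) p - b \is a mxOver Num.int.
    have := intmxD _ _ r1l1 l0b.
    by rewrite addrA (addrC r0) addrA subrK (addrAC r1).
  move=> /pi_valid; have := ND r1 r0; move: le1.
  move: (N (r1 + r0)) (N r0) (N r1) => a0 a1 a2; lra.
have pi'_le p : pi' p <= pi p by rewrite /pi'; case: eqP => [->|//]; exact: ltW.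
have /(congr1 (@^~ x)) := pi_min _ pi'_ge0 pi'_valid pi'_le.
by rewrite /pi' eqxx => E; rewrite E ltxx in x_gt.
Qed.

(** If the sum [S] exceeded 1, dividing the value at [x] alone by [S] would keep validity: by
    subadditivity, any representation of [b] that uses [x] costs at least [S] under [pi]. *)
Lemma minimal_sublinear_sym_le b pi x :
  minimal_sublinear_valid b pi -> 0 < pi x -> pi x + pi (b - x) <= 1.
Proof.
move=> pi_minv x_gt0; have [pi_ge0 pi_valid pi_min] := pi_minv.
rewrite leNgt; apply/negP; set S := _ + _ => S_gt1.
have S_gt0 : 0 < S by exact: lt_trans S_gt1.
pose pi' p := if p == x then pi x / S else pi p.
have pi'_geV p : pi p / S <= pi' p.
  rewrite /pi'; case: eqP => [->//|_].
  by rewrite ler_pdivrMr// ler_peMr// ltW.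
have pi'_le p : pi' p <= pi p.
  rewrite /pi'; case: eqP => [->//|_//].
  by rewrite ler_pdivrMr// ler_peMr// ltW.
have pi'_ge0 p : 0 <= pi' p.
  by apply: le_trans (pi'_geV p); rewrite divr_ge0// ltW.
have pi'_valid : sublinear_valid N b pi'.
  move=> r l lb; have [xl|xl] := boolP (x \in l); last first.
    rewrite (eq_big_seq pi) ?pi_valid// => p pl; rewrite /pi'.
    by case: eqP => // px; rewrite -px pl in xl.
  (* The points of [l] other than one copy of [x] represent [b - x]. *)
  have : pi (b - x) <= N r + \sum_(p <- rem x l) pi p.
    apply: minimal_sublinear_subadditive pi_minv _.
    move: lb; rewrite (perm_big _ (perm_to_rem xl)) big_cons /=.
    by rewrite opprB (addrCA r) (addrC x) addrA.
  rewrite -(lerD2l (pi x)) -/S addrCA.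
  have -> : pi x + \sum_(p <- rem x l) pi p = \sum_(p <- l) pi p.
    by rewrite (perm_big _ (perm_to_rem xl)) big_cons.
  move=> le_S; apply: (@le_trans _ _ ((N r + \sum_(p <- l) pi p) / S)).
    by rewrite ler_pdivlMr// mul1r.
  rewrite mulrDl lerD//; first by rewrite ler_pdivrMr// ler_peMr// ltW.
  by rewrite mulr_suml ler_sum.
(* Minimality gives [pi x / S = pi x], impossible since [pi x] is positive and [S] is not 1. *)
have /(congr1 (@^~ x)) := pi_min _ pi'_ge0 pi'_valid pi'_le.
rewrite /pi' eqxx => /eqP; rewrite -subr_eq0 -[X in _ - X]mulr1 -mulrBr mulf_eq0.
by rewrite gt_eqF//= subr_eq0 invr_eq1 gt_eqF.
Qed.

Lemma minimal_sublinear_sym b pi x :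
  minimal_sublinear_valid b pi -> pi x + pi (b - x) = 1.
Proof.
move=> pi_minv; have [pi_ge0 pi_valid _] := pi_minv; apply/le_anti/andP; split.
  have [x0|] := ltP 0 (pi x); first exact: minimal_sublinear_sym_le.
  (* When [pi x] is not positive, [x] and [b - x] exchange roles. *)
  move=> x0; have [bx0|bx0] := ltP 0 (pi (b - x)); last by lra.
  rewrite addrC -[X in _ + pi X](subKr b).
  exact: minimal_sublinear_sym_le.
have := pi_valid 0 [:: x; b - x].
rewrite !big_cons !big_nil !addr0 !add0r sublinear0 add0r; apply.
by rewrite (addrC x) subrK subrr intmx0.
Qed.

(** A valid [pi'] below [pi], of any sign, has sum at least 1 on the pair [x], [b - x], where [pi]
    has sum exactly 1; hence they agree at [x]. *)
Lemma minimal_sublinear_minimal_tuple b pi :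
  minimal_sublinear_valid b pi -> minimal_tuple b pi 1.
Proof.
move=> pi_minv; have [_ pi_valid _] := pi_minv; split.
  have [_ pi_mixed] := sublinear_valid_mixed _ _ pi_valid.
  split; [by constructor 3|move=> y /pi_mixed /=].
  by rewrite fsbig1 ?add0r// => r _; rewrite mulr0.
move=> [pi' [pi'_neq pi'_le pi'_valid]]; apply: pi'_neq; apply/funext => x.
have : 1 <= \sum_(p <- [:: x; b - x]) pi' p.
  apply: valid_integer_count_mem pi'_valid _.
  by rewrite !big_cons big_nil addr0 (addrC x) subrK subrr intmx0.
rewrite !big_cons big_nil addr0.
have := minimal_sublinear_sym _ _ x pi_minv.
by have := pi'_le x; have := pi'_le (b - x); lra.
Qed.

End SublinearLifting.

(** * Denominators, and integer points of a corner polyhedron *)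

Section RationalCorner.
Context {R : realType} {n : nat}.
Local Notation Rn := 'rV[R]_n.

(** The factor [D] makes every nonzero point of the lattice [(1/D) Z^n] cost at least 1. *)
Definition l1_gauge (D : nat) (r : Rn) : R := \sum_i `|(r *+ D) 0 i|.

Lemma l1_gauge_ge0 D r : 0 <= l1_gauge D r.
Proof. exact: sumr_ge0. Qed.

Lemma l1_gaugeD D r r' : l1_gauge D (r + r') <= l1_gauge D r + l1_gauge D r'.
Proof.
by rewrite -big_split ler_sum// => i _; rewrite mulrnDl mxE ler_normD.
Qed.

Lemma l1_gaugeZ D a r : 0 <= a -> l1_gauge D (a *: r) = a * l1_gauge D r.
Proof.
move=> a0; rewrite mulr_sumr; apply: eq_bigr => i _.
by rewrite scalerMnr mxE normrM ger0_norm.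
Qed.

Lemma l1_gauge_ge1 D r : (0 < D)%N -> r *+ D \is a mxOver Num.int -> r != 0 ->
  1 <= l1_gauge D r.
Proof.
move=> D_gt0 /mxOverP r_int /rV0Pn[i ri].
rewrite /l1_gauge (bigD1 i)//= -[leLHS]addr0 lerD ?sumr_ge0//.
by rewrite norm_intr_ge1// mulmxnE mulrn_eq0 negb_or -lt0n D_gt0.
Qed.

Lemma ratvec_denominator (p : Rn) : ratvec p ->
  exists2 D, (0 < D)%N & p *+ D \is a mxOver Num.int.
Proof.
move=> [q ->]; exists (\prod_i `|denq (q 0%R i)|)%N.
  by rewrite prodn_gt0// => i; rewrite absz_gt0.
apply/mxOverP => i j; rewrite ord1 mulmxnE mxE (bigD1 j)//= mulrnA.
rewrite rpredMn// -mulr_natr natr_absz ger0_norm ?denq_ge0//.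
by rewrite -[X in _ * X]ratr_int -rmorphM -numqE /= ratr_int intr_int.
Qed.

Lemma ratvec_common_denominator (s : seq Rn) : {in s, forall p, ratvec p} ->
  exists2 D, (0 < D)%N & {in s, forall p, p *+ D \is a mxOver Num.int}.
Proof.
elim: s => [|q s IHs] s_rat; first by exists 1%N.
have [p ps|D D_gt0 sD] := IHs; first by apply: s_rat; rewrite in_cons ps orbT.
have [D' D'_gt0 qD'] := ratvec_denominator _ (s_rat q (mem_head _ _)).
exists (D * D')%N; first by rewrite muln_gt0 D_gt0.
move=> p; rewrite in_cons => /predU1P[->|/sD pD].
  by rewrite mulnC mulrnA intmxMn.
by rewrite mulrnA intmxMn.
Qed.

Lemma sum_intmxMn (D : nat) (l : seq Rn) :
  {in l, forall p, p *+ D \is a mxOver Num.int} ->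
  (\sum_(p <- l) p) *+ D \is a mxOver Num.int.
Proof.
move=> lD; rewrite -sumrMnl big_seq.
by elim/big_ind: _ => [|u v|p /lD//]; [exact: intmx0|exact: intmxD].
Qed.

(** Vanishing off [P] cuts out a face of the hull. Carrying nonnegativity in [K] makes [K] convex:
    if a strict convex combination vanishes at a point, so do both of its terms. *)
Lemma conv_integer_model_face (b : Rn) (P : {fset Rn}) x :
  conv_integer_model b x -> (forall p, p \notin P -> x p = 0) ->
  exists2 y, integer_model b y & forall p, p \notin P -> y p = 0%N.
Proof.
pose K : set (Rn -> R^o) := [set x | (forall p, 0 <= x p) /\
  ((forall p, p \notin P -> x p = 0) ->
   exists2 y, integer_model b y & forall p, p \notin P -> y p = 0%N)].
suff xK : conv_integer_model b `<=` K by move=> /xK[_].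
apply: smallest_sub => [|_ [y yb <-]]; last first.
  split=> [p|y0]; first exact: ler0n.
  by exists y => // p /y0 /eqP; rewrite pnatr_eq0 => /eqP.
apply/convex_setW => u v; rewrite !inE => -[u0 uP] [v0 vP] k k_gt0 k_lt1.
have E p : conv k u v p = k%:num * u p + (1 - k%:num) * v p by [].
have k'_gt0 : 0 < 1 - k%:num by rewrite subr_gt0.
rewrite inE; split => [p|uv0].
  by rewrite E addr_ge0// mulr_ge0// ltW.
apply: uP => p /uv0 /eqP.
rewrite E paddr_eq0 ?mulr_ge0// ?(ltW k'_gt0)// => /andP[+ _].
by rewrite mulf_eq0 gt_eqF//= => /eqP.
Qed.

Lemma corner_polyhedron_count_mem (b : Rn) (P : {fset Rn}) (l : seq Rn) :
  \sum_(p <- l) p - b \is a mxOver Num.int -> {subset l <= P} ->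
  corner_polyhedron b P (restrict_coords P (fun p => (count_mem p l)%:R)).
Proof.
move=> /integer_model_count_mem lb lP.
exists (fun p => (count_mem p l)%:R) => //; split.
  by apply: sub_gen_smallest; exists (fun p => count_mem p l).
by move=> p pP; rewrite (count_memPn _)//; apply: contra pP => /lP.
Qed.

Lemma sum_restrict_count_mem (P : {fset Rn}) (f : Rn -> R) (l : seq Rn) :
  {subset l <= P} ->
  \sum_(p : P) f (val p) * restrict_coords P (fun p => (count_mem p l)%:R) p =
  \sum_(p <- l) f p.
Proof.
move=> lP; rewrite -(fsum_count_mem f l) (@fsbigTE _ _ _ _ P).
  by rewrite big_seq_fsetE; apply: eq_bigr => p _; rewrite ffunE mulr_natr.
by move=> p pP; rewrite (count_memPn _)//; apply: contra pP => /lP.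
Qed.

Lemma corner_polyhedron_nonempty (b : Rn) (P : {fset Rn}) :
  corner_polyhedron b P !=set0 ->
  exists2 l, \sum_(p <- l) p - b \is a mxOver Num.int & {subset l <= P}.
Proof.
move=> [_ [x [/conv_integer_model_face xb /xb[y [/= _ _ yfin yb] yP]] _]].
have [l yE] := exists_count_mem _ yfin; subst y; exists l.
  by move: yb; rewrite fsbig1 ?add0r ?fsum_count_mem// => r _; rewrite scale0r.
move=> p pl; apply: contraLR pl => /yP /eqP; rewrite -leqn0 leqNgt.
by rewrite -has_count has_pred1.
Qed.

Definition fset_extension (P : {fset Rn}) (gamma : {ffun P -> R}) (c : R)
    (p : Rn) : R := oapp gamma c (insub p).

Lemma fset_extension_val (P : {fset Rn}) (gamma : {ffun P -> R}) c (p : P) :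
  fset_extension P gamma c (val p) = gamma p.
Proof. by rewrite /fset_extension valK. Qed.

Lemma fset_extension_out (P : {fset Rn}) (gamma : {ffun P -> R}) c p :
  p \notin P -> fset_extension P gamma c p = c.
Proof. by move=> pP; rewrite /fset_extension insubN. Qed.

Lemma halfspace_fset_extension (b : Rn) (P : {fset Rn}) (gamma : {ffun P -> R})
    delta c (l : seq Rn) :
  corner_polyhedron b P `<=` halfspace gamma delta ->
  \sum_(p <- l) p - b \is a mxOver Num.int -> {subset l <= P} ->
  delta <= \sum_(p <- l) fset_extension P gamma c p.
Proof.
move=> gvalid lb lP; rewrite -(sum_restrict_count_mem P)//.
under eq_bigr do rewrite fset_extension_val.
exact/gvalid/corner_polyhedron_count_mem.
Qed.

(* For rational [P], the recession cone of a nonempty corner polyhedron is the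
   whole orthant: [D] copies of [p] can be added freely when [D p] is integral. *)
Lemma corner_valid_ge0 (b : Rn) (P : {fset Rn}) (gamma : {ffun P -> R}) delta :
  (forall p, p \in P -> ratvec p) -> corner_polyhedron b P !=set0 ->
  corner_polyhedron b P `<=` halfspace gamma delta -> forall p, 0 <= gamma p.
Proof.
move=> P_rat /corner_polyhedron_nonempty[l lb lP] gvalid p.
have [D D_gt0 pD] := ratvec_denominator _ (P_rat _ (valP p)).
rewrite leNgt; apply/negP => p_lt0.
set S := \sum_(q <- l) fset_extension P gamma 0 q.
have le_k k : delta <= S + gamma p *+ (D * k).
  have := halfspace_fset_extension b P gamma delta 0
    (l ++ nseq (D * k) (val p)) gvalid.
  rewrite !big_cat/= !big_nseq !iter_addr_0 fset_extension_val; apply.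
    by rewrite addrAC intmxD// mulrnA intmxMn.
  by move=> q; rewrite mem_cat mem_nseq => /orP[/lP//|/andP[_ /eqP->]]; exact: valP.
(* With this [k], already [S + k * gamma p < delta]; the factor [D >= 1] only lowers the left side
   further. *)
have [k k_gt] : exists k : nat, (S - delta) / - gamma p < k%:R.
  by exists (Num.truncn ((S - delta) / - gamma p)).+1; exact: truncnS_gt.
have := le_k k; rewrite leNgt => /negP; apply.
move: k_gt; rewrite ltr_pdivrMr ?oppr_gt0// mulrN => k_gt.
have : gamma p *+ (D * k) <= gamma p *+ k by rewrite ler_wnMn2l ?ltW// leq_pmull.
by rewrite -[X in _ <= X]mulr_natl; lra.
Qed.

End RationalCorner.

(** * Construction of the dominating tuple *)

Theorem theorem5p4 (R : realType) (n : nat) (b : 'rV[R]_n)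
    (hb : b \isn't a mxOver Num.int)
    (P : {fset 'rV[R]_n}) (hP : forall p, p \in P -> ratvec p)
    (hC : corner_polyhedron b P !=set0)
    (gamma : {ffun P -> R}) (delta : R)
    (hvalid : corner_polyhedron b P `<=` halfspace gamma delta)
    (hnvalid : ~ (orthant P `<=` halfspace gamma delta)) :
  exists (pi : 'rV[R]_n -> R) (alpha : R),
    [/\ minimal_tuple b pi alpha,
        ~ trivial_tuple pi alpha,
        liftable_tuple b pi alpha &
        ineq_dominated gamma delta (restrict_coords P pi) alpha].
Proof.
have gamma_ge0 := corner_valid_ge0 b P gamma delta hP hC hvalid.
have delta_gt0 : 0 < delta.
  rewrite ltNge; apply/negP => delta_le0; apply: hnvalid => y y_ge0.
  by apply: le_trans delta_le0 _; apply: sumr_ge0 => p _; rewrite mulr_ge0.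
have [l0 l0b l0P] := corner_polyhedron_nonempty b P hC.
have [D D_gt0 PD] := ratvec_common_denominator P hP.
(* Modulo [Z^n], [b] is a sum of points of [P], so [D] clears its denominators too. *)
have bD : b *+ D \is a mxOver Num.int.
  rewrite -[b](subKr (\sum_(p <- l0) p)) mulrnDl intmxD//.
    by apply: sum_intmxMn => p /l0P /PD.
  by rewrite intmxMn// intmxN.
(* The default [delta] becomes the value 1 outside [P]. *)
pose pi0 p := fset_extension P gamma delta p / delta.
have pi0_ge0 p : 0 <= pi0 p.
  rewrite divr_ge0 ?(ltW delta_gt0)// /fset_extension.
  by case: insub => //=; exact: ltW.
have pi0_valid : sublinear_valid (l1_gauge D) b pi0.
  move=> r l lb; have [lP|/allPn[q ql qP]] := boolP (all (mem P) l); last first.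
    apply: ler_wpDl; first exact: l1_gauge_ge0.
    rewrite (perm_big _ (perm_to_rem ql)) big_cons /=.
    rewrite /pi0 fset_extension_out// divff ?gt_eqF// lerDl.
    by apply: sumr_ge0 => p _; exact: pi0_ge0.
  have {}lP : {subset l <= P} by exact/allP.
  have [r0|r_neq0] := eqVneq r 0.
    rewrite r0 add0r in lb *; apply: ler_wpDl; first exact: l1_gauge_ge0.
    rewrite -mulr_suml ler_pdivlMr// mul1r.
    exact: halfspace_fset_extension hvalid lb lP.
  apply: ler_wpDr; first exact: sumr_ge0.
  apply: l1_gauge_ge1 => //.
  (* Modulo [Z^n], [r] is [b] minus a sum of points of [P], so [r *+ D] is integral. *)
  have := intmxMn _ D lb; rewrite mulrnBl mulrnDl => rD.
  rewrite -[r *+ D](addrK ((\sum_(p <- l) p) *+ D)) intmxD//; last first.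
    by rewrite intmxN// sum_intmxMn// => p /lP /PD.
  by rewrite -[X in X \is a _](subrK (b *+ D)) intmxD.
have [pi pi_min pi_le] := exists_minimal_sublinear_valid _ _ _ pi0_ge0 pi0_valid.
exists pi, 1; split.
- apply: minimal_sublinear_minimal_tuple pi_min.
  + exact: l1_gauge_ge0.
  + exact: l1_gaugeD.
  + exact: l1_gaugeZ.
- by move=> [_ [] alphaE]; lra.
- exists (l1_gauge D); case: pi_min => _ pi_valid _.
  apply: sublinear_valid_mixed pi_valid.
  + exact: l1_gaugeD.
  + exact: l1_gaugeZ.
- move=> y [y_ge0]; rewrite /halfspace /= => pi_y.
  (* Since [pi <= pi0], each [gamma p] is at least [delta * pi p]. *)
  apply: (@le_trans _ _ (delta * \sum_p restrict_coords P pi p * y p)).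
    by rewrite ler_peMr// ltW.
  rewrite mulr_sumr ler_sum// => p _; rewrite mulrA ler_wpM2r//.
  rewrite ffunE mulrC -ler_pdivlMr//; apply: le_trans (pi_le _) _.
  by rewrite /pi0 fset_extension_val.
Qed.
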